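(* Let $k$ be a positive integer, let $G$ be a $k$-connected graph, and let $W\subsetneq V(G)$. Set $U=V(G)\setminus W$ and $w=|W|$. If \[ d_G(x)\ge \max\{k+1,w+1\} \] for every $x\in U$, then $G[U]$ contains an edge that is $k$-removable in $G$.
   Context: All graphs are finite, undirected and simple. A graph is $k$-connected in the usual sense: it has more than $k$ vertices and deleting any set of fewer than $k$ vertices leaves a connected graph. $G[U]$ is the subgraph of $G$ induced by $U$, and $d_G(x)$ is the degree of $x$ in $G$. An edge $e$ of a $k$-connected graph $G$ is $k$-removable if $G-e$ (delete the edge $e$, keep all vertices) is $k$-connected. *)

(* Defs.v *)
From mathcomp Require Import all_boot.

Set Implicit Arguments.
Unset Strict Implicit.
Unset Printing Implicit Defensive.

Record sgraph := SGraph {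
  vertex :> finType;
  adj : rel vertex;
  adj_sym : symmetric adj;
  adj_irrefl : irreflexive adj }.

Section Graphs.
Variable G : sgraph.
Implicit Types (x y : G) (U S : {set G}).

Definition degree x : nat := #|[set y | adj x y]|.

Definition connected : Prop :=
  0 < #|G| /\ forall x y, connect (@adj G) x y.

Definition induced_adj U : rel {x : G | x \in U} :=
  fun u v => adj (val u) (val v).

Lemma induced_adj_sym U : symmetric (@induced_adj U).
Proof. by move=> u v; exact: adj_sym. Qed.

Lemma induced_adj_irrefl U : irreflexive (@induced_adj U).
Proof. by move=> u; exact: adj_irrefl. Qed.

Definition induced U : sgraph :=
  SGraph (@induced_adj_sym U) (@induced_adj_irrefl U).

Definition del_edge_adj x y : rel G :=
  fun u v => adj u v && ([set u; v] != [set x; y]).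

Lemma del_edge_adj_sym x y : symmetric (del_edge_adj x y).
Proof. by move=> u v; rewrite /del_edge_adj adj_sym setUC. Qed.

Lemma del_edge_adj_irrefl x y : irreflexive (del_edge_adj x y).
Proof. by move=> u; rewrite /del_edge_adj adj_irrefl. Qed.

Definition del_edge x y : sgraph :=
  SGraph (@del_edge_adj_sym x y) (@del_edge_adj_irrefl x y).

End Graphs.

Definition k_connected (k : nat) (G : sgraph) : Prop :=
  k < #|G| /\
  forall S : {set G}, #|S| < k -> connected (induced (~: S)).

(* The edge is given by its two ends x and y, in either order. *)
Definition k_removable (k : nat) (G : sgraph) (x y : G) : Prop :=
  adj x y /\ k_connected k (del_edge x y).

(* Main.v *)
Require Import Defs.
From mathcomp Require Import all_boot zify.

Set Implicit Arguments.
Unset Strict Implicit.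
Unset Printing Implicit Defensive.

(** Suppose that every edge of G[U] is critical.  A critical edge xy comes with
    a separation V(G) = D + S + E such that x is in D, y is in E, |S| < k and xy
    is the only edge between D and E.  If x has degree greater than k and xz is
    another critical edge, with separation D' + S' + E', then uncrossing the two
    separations gives |E'| < |D| (Mader): the side lying ahead strictly shrinks
    along a non-backtracking walk.  Hence no nonempty subset of U induces a
    subgraph of minimum degree 2, i.e. G[U] is a forest.  A leaf x of G[U]
    exists and is adjacent to all of W, so for the edge xy of G[U] at x the side
    E is disjoint from W.  All vertices of E then have two neighbours in E,
    except y which has at least one; this is impossible in a forest. *)

(** * Separations crossed by a single edge *)

Definition nbrs_in (G : sgraph) (A : {set G}) (x : G) : {set G} :=
  [set y in A | adj x y].

Definition edge_sep (k : nat) (G : sgraph) (D E : {set G}) (x y : G) : bool :=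
  [&& x \in D, y \in E, [disjoint D & E], #|~: (D :|: E)| < k &
   [forall u in D, forall v in E, adj u v ==> (u == x) && (v == y)]].

Section Separations.
Variables (k : nat) (G : sgraph).
Implicit Types (x y z u v : G) (A B D E U W : {set G}).

Lemma edge_sepP D E x y :
  reflect [/\ x \in D, y \in E, [disjoint D & E], #|~: (D :|: E)| < k &
           forall u v, u \in D -> v \in E -> adj u v -> u = x /\ v = y]
          (edge_sep k D E x y).
Proof.
apply: (iffP and5P) => -[xD yE dDE ltS H]; split=> //.
  move=> u v uD vE uv.
  move/forall_inP/(_ _ uD)/forall_inP/(_ _ vE)/implyP/(_ uv)/andP: H.
  by case=> [/eqP-> /eqP->].
apply/forall_inP => u uD; apply/forall_inP => v vE; apply/implyP => uv.
by have [-> ->] := H u v uD vE uv; rewrite !eqxx.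
Qed.

Lemma edge_sep_sym D E x y : edge_sep k D E x y -> edge_sep k E D y x.
Proof.
case/edge_sepP=> xD yE dDE ltS H; apply/edge_sepP; split=> //.
- by rewrite disjoint_sym.
- by rewrite setUC.
- by move=> u v uE vD; rewrite adj_sym => vu; have [-> ->] := H _ _ vD uE vu.
Qed.

(** Were the complement smaller, deleting it would leave a connected graph in which [A] is closed
    under adjacency, putting [b] in [A]. *)
Lemma k_connected_separator A B a b :
  k_connected k G -> a \in A -> b \in B -> [disjoint A & B] ->
  (forall u v, u \in A -> v \in B -> ~~ adj u v) -> k <= #|~: (A :|: B)|.
Proof.
move=> [_ conG] aA bB dAB H; rewrite leqNgt; apply/negP=> /conG [_].
have aS : a \in ~: ~: (A :|: B) by rewrite setCK inE aA.
have bS : b \in ~: ~: (A :|: B) by rewrite setCK inE bB orbT.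
move=> /(_ (exist _ a aS) (exist _ b bS)) con.
pose P := [pred u : induced (~: ~: (A :|: B)) | val u \in A].
have /closed_connect clP : closed (@adj (induced (~: ~: (A :|: B)))) P.
  apply: intro_closed; first exact/sym_connect_sym/adj_sym.
  move=> u [v vS] uv uA; have : v \in A :|: B by rewrite -[_ :|: _]setCK.
  rewrite inE => /orP[//|vB].
  by have := H _ _ uA vB; rewrite -[X in ~~ X]/(adj u (exist _ v vS)) uv.
have := clP _ _ con; rewrite !inE /= aA => /esym bA.
by rewrite (disjointFr dAB bA) in bB.
Qed.

(** If deleting [S] separates [u] from [v] once xy is gone, let [A] be the component of [u] and [B]
    the rest. Connectivity of [G] forces an edge between them, and it can only be xy, in one of its
    two orientations. *)
Lemma critical_edge_sep x y :
  k_connected k G -> adj x y ->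
  (forall D E, ~~ edge_sep k D E x y) -> k_connected k (del_edge x y).
Proof.
move=> conG xy noSep; case: (conG) => ltkG _; split=> // S ltS; split.
  have : 0 < #|~: S|.
    by have := cardsC S; rewrite -[#|del_edge x y|]/#|G|; lia.
  by case/card_gt0P=> t tS; apply/card_gt0P; exists (exist _ t tS).
move=> u v; apply/negPn/negP => ncon.
pose H := @induced (del_edge x y) (~: S).
pose A : {set G} := [set val t | t : H & connect (@adj H) u t].
pose B : {set G} := ~: (A :|: S).
have mA (t : H) : (val t \in A) = connect (@adj H) u t.
  apply/imsetP/idP => [[t']|ct]; last by exists t; rewrite ?inE.
  by rewrite inE => ct' /val_inj ->.
have AS t : t \in A -> t \in ~: S by case/imsetP => t' _ ->; exact: (valP t').
have uA : val u \in A by rewrite mA connect0.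
have vB : val v \in B.
  by rewrite !inE mA (negPf ncon) /=; have := valP v; rewrite inE.
have dAB : [disjoint A & B].
  by rewrite disjoints_subset setCK subsetUl.
have SAB : ~: (A :|: B) = S.
  apply/setP=> t; rewrite !inE; have := AS t; rewrite !inE.
  by case: (t \in A) => //=; [move/(_ isT)/negPf-> | rewrite negbK].
have key s t : s \in A -> t \in B -> adj s t -> [set s; t] = [set x; y].
  move=> sA tB st; apply/eqP/negPn/negP => nst.
  have tS : t \in ~: S by move: tB; rewrite !inE negb_or => /andP[].
  have := mA (exist _ t tS); have := tB; rewrite !inE negb_or /= => /andP[/negPf-> _].
  move/esym/negP; apply.
  have cs : connect (@adj H) u (exist _ s (AS s sA)) by rewrite -mA.
  apply: connect_trans cs (connect1 _).
  by rewrite /= /induced_adj /= /del_edge_adj st.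
case: (boolP [exists s in A, exists t in B, adj s t]); last first.
  move=> /exists_inPn noE.
  have := k_connected_separator conG uA vB dAB; rewrite SAB leqNgt ltS.
  by move=> /(_ _)/notF; apply=> s t /noE /exists_inPn; apply.
move=> /exists_inP[s sA /exists_inP[t tB st]].
(* Two edges from [A] to [B] with the same pair of ends agree end by end, as [A] and [B] are
   disjoint. *)
have sep : edge_sep k A B s t.
  apply/edge_sepP; split; rewrite ?SAB // => s' t' s'A t'B s't'.
  have := key _ _ sA tB st; rewrite -(key _ _ s'A t'B s't') => /setP E.
  have := E s'; have := E t'; rewrite !inE !eqxx /= !orbT.
  have ne a b : a \in A -> b \in B -> (a == b) = false.
    by move=> aA bB; apply/eqP=> ab; rewrite ab (disjointFl dAB bB) in aA.
  by rewrite [t' == s]eq_sym (ne s t') // (ne s' t) // orbF => /eqP-> /eqP->.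
have := key _ _ sA tB st => /setP E.
have sxy := E s; have txy := E t.
have st' : s != t by apply/eqP=> e; rewrite e adj_irrefl in st.
move: sxy txy; rewrite !inE !eqxx /= orbT => /esym/orP[]/eqP es /esym/orP[]/eqP et.
- by rewrite es et eqxx in st'.
- by have := noSep A B; rewrite -es -et sep.
- by have := noSep B A; rewrite -es -et (edge_sep_sym sep).
- by rewrite es et eqxx in st'.
Qed.

Lemma degree_sum_sep D E x y :
  edge_sep k D E x y -> degree x <= #|nbrs_in D x| + #|~: (D :|: E)| + 1.
Proof.
case/edge_sepP=> xD yE dDE ltS H; rewrite -(cards1 y).
apply: leq_trans (leq_trans (leq_card_setU _ _)
                            (leq_add (leq_card_setU _ _) (leqnn _))).
apply/subset_leq_card/subsetP=> v; rewrite !inE => xv; rewrite xv andbT.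
case: (boolP (v \in D)) => //= vD; case: (boolP (v \in E)) => //= vE.
by have [_ ->] := H _ _ xD vE xv.
Qed.

(** The degree of [x] gives it a neighbour in [D]. Moving [x] into the separator then cuts the rest
    of [D] off from [E], so k-connectedness bounds the separator from below by [k - 1]. *)
Lemma card_edge_sep D E x y :
  k_connected k G -> k < degree x -> edge_sep k D E x y ->
  #|~: (D :|: E)|.+1 = k.
Proof.
move=> conG degx sep; have := degree_sum_sep sep.
case/edge_sepP: sep => xD yE dDE ltS H degle.
have [a] : exists a, a \in nbrs_in D x by apply/card_gt0P; lia.
rewrite !inE => /andP[aD xa].
have ax : a != x by apply/eqP=> e; rewrite e adj_irrefl in xa.
have aDx : a \in D :\ x by rewrite !inE ax.
have : k <= #|~: ((D :\ x) :|: E)|.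
  apply: (k_connected_separator conG aDx yE).
    by apply: disjointWl dDE; exact: subD1set.
  move=> u v; rewrite !inE => /andP[ux uD] vE; apply/negP=> uv.
  by have [e _] := H _ _ uD vE uv; rewrite e eqxx in ux.
suff : #|~: ((D :\ x) :|: E)| <= #|~: (D :|: E)| + 1 by lia.
rewrite -(cards1 x); apply: leq_trans (leq_card_setU _ _).
apply/subset_leq_card/subsetP=> v; rewrite !inE.
by case: (v == x); rewrite /= ?orbT ?orbF.
Qed.

(** * Uncrossing two separations, and the forest this yields *)

Lemma card_trisect D E A :
  [disjoint D & E] -> #|A| = #|A :&: D| + #|A :&: ~: (D :|: E)| + #|A :&: E|.
Proof.
move=> dDE; rewrite -(cardsID D A) -addnA -(cardsID E (A :\: D)) [X in _ + X]addnC.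
congr (_ + (_ + _)); apply: eq_card => v; rewrite !inE.
  by case: (v \in A); case: (v \in D); case: (v \in E).
by case: (boolP (v \in D)) => [vD|]; rewrite ?(disjointFr dDE vD) ?andbF.
Qed.

Lemma side_decrease D E D' E' x y z :
  k_connected k G -> k < degree x -> y != z -> adj x y -> adj x z ->
  edge_sep k D E x y -> edge_sep k D' E' x z -> #|E'| < #|D|.
Proof.
move=> conG degx yz xy xz sep sep'.
have cS := card_edge_sep conG degx sep; have cS' := card_edge_sep conG degx sep'.
case/edge_sepP: sep => xD yE dDE _ H.
case/edge_sepP: sep' => xD' zE' dDE' _ H'.
have yE' : y \notin E'.
  by apply/negP=> yE'; have [_ e] := H' _ _ xD' yE' xy; rewrite e eqxx in yz.
have zE : z \notin E.
  by apply/negP=> zE; have [_ e] := H _ _ xD zE xz; rewrite e eqxx in yz.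
pose S := ~: (D :|: E); pose S' := ~: (D' :|: E').
pose T := (S :&: D') :|: (S :&: S') :|: (D :&: S').
have cT : #|T| <= #|S :&: D'| + #|S :&: S'| + #|D :&: S'|.
  exact: leq_trans (leq_card_setU _ _) (leq_add (leq_card_setU _ _) (leqnn _)).
(* [T] bounds the corner [D :&: D']. If the corner is just [x], all neighbours of [x] lie in [T],
   [y] and [z], and the degree gives the bound; otherwise [T] with [x] separates the rest of the
   corner from [y]. *)
have kT : k <= #|T| + 1.
  case: (boolP [exists a in D :&: D', a != x]); last first.
    move=> /exists_inPn noa; suff /(leq_trans degx) : degree x <= #|T| + 1 + 1 by rewrite addn1 ltnS.
    rewrite -{1}(cards1 y) -(cards1 z).
    apply: leq_trans (leq_trans (leq_card_setU _ _)
                                (leq_add (leq_card_setU _ _) (leqnn _))).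
    apply/subset_leq_card/subsetP=> v; rewrite inE => xv.
    have nDD : ~~ ((v \in D) && (v \in D')).
      apply/negP=> vDD; have := noa v; rewrite inE negbK => /(_ vDD)/eqP e.
      by rewrite e adj_irrefl in xv.
    have vE : v \in E -> v == y by move=> vE; have [_ ->] := H _ _ xD vE xv.
    have vE' : v \in E' -> v == z by move=> vE'; have [_ ->] := H' _ _ xD' vE' xv.
    move: nDD vE vE'; rewrite !inE; do !case: (_ \in _) => //=;
      by do !case: (_ == _) => //=; move=> *; auto.
  move=> /exists_inP[a aDD ax].
  pose A := (D :&: D') :\ x; pose B := ~: (A :|: (x |: T)).
  have aA : a \in A by rewrite in_setD1 ax.
  have yB : y \in B.
    have yx : y != x by apply/eqP=> e; rewrite e adj_irrefl in xy.
    by rewrite !inE (negPf yx) yE (disjointFl dDE yE).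
  have dAB : [disjoint A & B] by rewrite disjoints_subset setCK subsetUl.
  have : k <= #|~: (A :|: B)|.
    apply: (k_connected_separator conG aA yB dAB) => u v.
    rewrite !inE => /and3P[ux uD uD'] vB; apply/negP=> uv.
    have vE : v \in E = false.
      by apply/negP=> vE; have [e _] := H _ _ uD vE uv; rewrite e eqxx in ux.
    have vE' : v \in E' = false.
      by apply/negP=> vE'; have [e _] := H' _ _ uD' vE' uv; rewrite e eqxx in ux.
    move: vB; rewrite vE vE'.
    by case: (v == x) => //=; case: (v \in D); case: (v \in D').
  have : #|~: (A :|: B)| <= #|[set x]| + #|T|.
    apply: leq_trans (leq_card_setU _ _).
    apply/subset_leq_card; rewrite setCU setCK setIUr.
    by rewrite [~: A :&: A]setIC setICr set0U subsetIr.
  by rewrite cards1 addnC => leT /leq_trans; apply.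
pose T' := (S :&: E') :|: (S :&: S') :|: (E :&: S').
have cT' : #|T'| <= #|S :&: E'| + #|S :&: S'| + #|E :&: S'|.
  exact: leq_trans (leq_card_setU _ _) (leq_add (leq_card_setU _ _) (leqnn _)).
have cSS := card_trisect S dDE'; have cSS' := card_trisect S' dDE.
rewrite -/S' in cSS; rewrite -/S !(setIC S') in cSS'.
rewrite -/S in cS; rewrite -/S' in cS'.
(* Neither crossing edge ends in the opposite corner, so if nonempty it is separated from [x] by
   [T'], whence [k <= #|T'|]. But [#|T| + #|T'|] is at most [#|S| + #|S'|], that is [2k - 2], and
   [#|T|] is at least [k - 1]. *)
have EE0 : E :&: E' = set0.
  apply/eqP/negPn/negP => /set0Pn[b bA].
  pose B := ~: ((E :&: E') :|: T').
  have xB : x \in B.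
    by rewrite !inE xD xD' (disjointFr dDE xD) (disjointFr dDE' xD').
  have dAB : [disjoint E :&: E' & B] by rewrite disjoints_subset setCK subsetUl.
  have : k <= #|~: ((E :&: E') :|: B)|.
    apply: (k_connected_separator conG bA xB dAB) => u v.
    rewrite !inE => /andP[uE uE'] vB; apply/negP=> uv.
    have vD : v \in D = false.
      apply/negP=> vD; rewrite adj_sym in uv.
      by have [_ e] := H _ _ vD uE uv; rewrite -e uE' in yE'.
    have vD' : v \in D' = false.
      apply/negP=> vD'; rewrite adj_sym in uv.
      by have [_ e] := H' _ _ vD' uE' uv; rewrite -e uE in zE.
    by move: vB; rewrite vD vD'; case: (v \in E); case: (v \in E').
  have : #|~: ((E :&: E') :|: B)| <= #|T'|.
    apply/subset_leq_card; rewrite setCU setCK setIUr.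
    by rewrite [~: (E :&: E') :&: _]setIC setICr set0U subsetIr.
  move=> leT' /leq_trans/(_ leT'); move: kT cT cT' cS cS' cSS cSS'.
  by clear; clearbody S S' T T'; lia.
(* As [#|T| >= #|S|], [S :&: E'] is no larger than [D :&: S']; the vertex [x] of [D :&: D'] makes
   the inequality strict. *)
have := card_trisect D dDE'; have := card_trisect E' dDE; rewrite -/S -/S'.
rewrite [E' :&: E]setIC EE0 cards0 [E' :&: D]setIC [E' :&: S]setIC.
have : 0 < #|D :&: D'| by apply/card_gt0P; exists x; rewrite inE xD.
by move: kT cT cS cSS; clear; clearbody S S' T; lia.
Qed.

(* Take an edge of G[A] and an orientation of it minimizing the side ahead;
   leaving its head along another edge of G[A] gives a smaller side. *)
Lemma critical_acyclic A a :
  k_connected k G -> a \in A ->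
  (forall x, x \in A -> k < degree x) ->
  (forall x y, x \in A -> y \in A -> adj x y -> exists D E, edge_sep k D E x y) ->
  exists2 x, x \in A & #|nbrs_in A x| <= 1.
Proof.
move=> conG aA degA crit.
case: (boolP [exists x in A, #|nbrs_in A x| <= 1]) => [/exists_inP//|/exists_inPn noleaf].
exfalso.
have min2 x : x \in A -> 1 < #|nbrs_in A x| by move/noleaf; rewrite -ltnNge.
pose P (p : (G * G) * ({set G} * {set G})) :=
  [&& p.1.1 \in A, p.1.2 \in A, adj p.1.1 p.1.2 & edge_sep k p.2.1 p.2.2 p.1.1 p.1.2].
have [b] : exists b, b \in nbrs_in A a by apply/card_gt0P; have := min2 _ aA; lia.
rewrite inE => /andP[bA ab]; have [D0 [E0 sep0]] := crit _ _ aA bA ab.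
have P0 : P ((a, b), (D0, E0)) by rewrite /P /= aA bA ab.
(* The edge is walked from [y] to [x], so the side ahead is [D]. *)
case: (arg_minnP (fun p : (G * G) * ({set G} * {set G}) => #|p.2.1|) P0) => -[[x y] [D E]] /and4P[/= xA yA xy sep] Pmin.
have [z] : exists z, z \in nbrs_in A x :\ y.
  by apply/card_gt0P; have := min2 _ xA; rewrite (cardsD1 y) inE yA xy.
rewrite !inE => /and3P[zy zA xz]; have [D' [E' sep']] := crit _ _ xA zA xz.
have Pz : P ((z, x), (E', D')).
  by rewrite /P /= zA xA adj_sym xz edge_sep_sym.
have := Pmin _ Pz; rewrite leqNgt /= => /negP; apply.
by apply: side_decrease sep sep' => //; [exact: degA | rewrite eq_sym].
Qed.

End Separations.

(* A forest with an edge has two leaves: strip the vertex r of degree one, whose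
   neighbour becomes the new exceptional vertex. *)
Lemma acyclic_two_leaves (G : sgraph) (U A : {set G}) (r : G) :
  (forall B : {set G}, B \subset U -> B != set0 ->
     exists2 x, x \in B & #|nbrs_in B x| <= 1) ->
  A \subset U -> r \in A -> 0 < #|nbrs_in A r| ->
  exists x, [/\ x \in A, x != r & #|nbrs_in A x| <= 1].
Proof.
move=> leaf; have [n] := ubnP #|A|; elim: n A r => // n IHn A r ltA sAU rA degr.
case: (boolP [exists x in A :\ r, #|nbrs_in A x| <= 1]).
  by case/exists_inP=> x; rewrite !inE => /andP[xr xA] degx; exists x.
move=> /exists_inPn noleaf.
have min2 x : x \in A -> x != r -> 1 < #|nbrs_in A x|.
  by move=> xA xr; rewrite ltnNge; apply: noleaf; rewrite !inE xr.
have degr1 : #|nbrs_in A r| = 1.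
  have [|x xA degx] := leaf A sAU; first by apply/set0Pn; exists r.
  have [e|xr] := eqVneq x r; last by have := min2 _ xA xr; lia.
  by rewrite e in degx; lia.
have /cards1P [s Nr] : #|nbrs_in A r| == 1 by rewrite degr1.
have : s \in nbrs_in A r by rewrite Nr inE.
rewrite inE => /andP[sA rs].
have sr : s != r by apply/eqP=> e; rewrite e adj_irrefl in rs.
have nbrsD x : nbrs_in (A :\ r) x = nbrs_in A x :\ r.
  by apply/setP=> v; rewrite !inE andbA.
have sA' : s \in A :\ r by rewrite !inE sr.
have [||||x [xA' xs degx]] := IHn (A :\ r) s.
- by rewrite (cardsD1 r A) rA in ltA.
- exact: subset_trans (subD1set _ _) sAU.
- by [].
- by rewrite nbrsD; have := min2 _ sA sr; rewrite (cardsD1 r); case: (r \in _); lia.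
(* As [x] is not [s], the only neighbour of [r], stripping [r] left its degree unchanged. *)
move: xA'; rewrite !inE => /andP[xr xA]; exists x; split=> //.
move: degx; rewrite nbrsD (cardsD1 r (nbrs_in A x)) inE rA /=.
case: (boolP (adj x r)) => //= xr'.
have : x \in nbrs_in A r by rewrite inE xA adj_sym.
by rewrite Nr inE (negPf xs).
Qed.

(** * A leaf of G[U] and the side beyond its edge *)

Theorem corollary1p5 (k : nat) (G : sgraph) (W : {set G}) :
  0 < k ->
  k_connected k G ->
  W \proper [set: G] ->
  (forall x : G, x \in ~: W -> maxn (k + 1) (#|W| + 1) <= degree x) ->
  exists u v : induced (~: W), adj u v /\ k_removable k (val u) (val v).
Proof.
move=> _ conG propW degU.
pose crit x y := [exists D : {set G}, exists E : {set G}, edge_sep k D E x y].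
case: (boolP [exists x in ~: W, exists y in ~: W, adj x y && ~~ crit x y]).
  move=> /exists_inP[x xU /exists_inP[y yU /andP[xy ncrit]]].
  exists (exist _ x xU), (exist _ y yU); split=> //; split=> //.
  apply: critical_edge_sep => // D E.
  by move: ncrit => /existsPn/(_ D)/existsPn/(_ E).
move=> /exists_inPn allcrit; exfalso.
have critU x y : x \in ~: W -> y \in ~: W -> adj x y ->
    exists D E, edge_sep k D E x y.
  move=> xU yU xy; have /exists_inPn/(_ y yU) := allcrit x xU.
  by rewrite xy negbK => /existsP[D /existsP[E sep]]; exists D, E.
have degk x : x \in ~: W -> k < degree x by move/degU; lia.
have leafU (B : {set G}) : B \subset ~: W -> B != set0 ->
    exists2 x, x \in B & #|nbrs_in B x| <= 1.
  move=> /subsetP sBU /set0Pn[b bB]; apply: (@critical_acyclic k _ _ b) => //.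
    by move=> x /sBU; exact: degk.
  by move=> x y /sBU xU /sBU yU; exact: critU.
have [|x xU degx] := leafU _ (subxx _).
  by case/properP: propW => _ [v _ vW]; apply/set0Pn; exists v; rewrite inE.
have degxE : degree x = #|nbrs_in (~: W) x| + #|nbrs_in W x|.
  rewrite /degree -(cardsID (~: W)); congr (_ + _); apply: eq_card => v.
    by rewrite !inE andbC.
  by rewrite !inE negbK.
have sNW : nbrs_in W x \subset W by apply/subsetP=> v; rewrite inE => /andP[].
have cNW := subset_leq_card sNW; have degxW := degU x xU.
(* At most one of the at least [#|W| + 1] neighbours of [x] lies outside [W]. *)
have NW : nbrs_in W x = W by apply/eqP; rewrite eqEcard sNW; lia.
have [y] : exists y, y \in nbrs_in (~: W) x by apply/card_gt0P; lia.
rewrite inE => /andP[yU xy].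
have [D [E sep]] := critU _ _ xU yU xy.
have /edge_sepP[xD yE dDE ltS H] := sep.
have sEU : E \subset ~: W.
  apply/subsetP=> v vE; rewrite inE; apply/negP=> vW.
  have : v \in nbrs_in W x by rewrite NW.
  rewrite inE => /andP[_ xv]; have [_ e] := H _ _ xD vE xv.
  by move: yU; rewrite inE -e vW.
have yDE := degree_sum_sep (edge_sep_sym sep); rewrite [E :|: D]setUC in yDE.
have [|v [vE vy degv]] := acyclic_two_leaves leafU sEU yE.
  by move: (degk y yU) yDE ltS; clear; lia.
(* Since [v] is not [y], it has no neighbour in [D]; its degree is then at most [1 + (k - 1)], a
   contradiction. *)
have : degree v <= #|nbrs_in E v| + #|~: (D :|: E)|.
  apply: leq_trans (leq_card_setU _ _).
  apply/subset_leq_card/subsetP=> t; rewrite !inE => vt; rewrite vt andbT.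
  case: (boolP (t \in E)) => //= tE; rewrite orbF; apply/negP=> tD.
  by have [_ e] := H _ _ tD vE (etrans (adj_sym _ _) vt); rewrite e eqxx in vy.
by move: (degk v (subsetP sEU v vE)) degv ltS; clear; lia.
Qed.
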